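(* Let $c\colon\mathbb{R}\to\mathbb{Z}$ be an integral 1-dimensional Delone configuration with a non-trivial integral annihilator. Then $c$ is periodic.
   Context: A set $S\subseteq\mathbb{R}$ is a (1-dimensional) Delone set if it is uniformly discrete (there is $r>0$ such that every open ball, i.e. open interval $(x-r,x+r)$, contains at most one point of $S$) and relatively dense (there is $R>0$ such that every closed interval $[x-R,x+R]$ contains at least one point of $S$). A 1-dimensional Delone configuration is a function $c\colon\mathbb{R}\to\mathbb{C}$ taking only finitely many values whose support $\mathrm{supp}(c)=\{u\mid c(u)\neq 0\}$ is a Delone set. A function is integral if all its values are integers. An annihilator of $c$ is a finitely supported function $f\colon\mathbb{R}\to\mathbb{C}$ such that $\sum_{v\in\mathrm{supp}(f)} f(v)\,c(u-v)=0$ for all $u\in\mathbb{R}$; non-trivial means non-zero. $c$ is periodic if there is a non-zero $t\in\mathbb{R}$ with $c(u-t)=c(u)$ for all $u\in\mathbb{R}$. *)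

(* Defs.v *)
From mathcomp Require Import all_boot all_order all_algebra.
From mathcomp Require Import all_classical all_reals all_analysis.
From mathcomp Require Import complex.

Set Implicit Arguments.
Unset Strict Implicit.
Unset Printing Implicit Defensive.

Import Order.TTheory GRing.Theory Num.Theory.

Local Open Scope classical_set_scope.
Local Open Scope ring_scope.

Definition uniformly_discrete (R : realType) (S : set R) : Prop :=
  exists2 r : R, 0 < r & forall x : R, is_subset1 (S `&` `]x - r, x + r[).

Definition relatively_dense (R : realType) (S : set R) : Prop :=
  exists2 r : R, 0 < r & forall x : R, S `&` `[x - r, x + r] !=set0.

Definition delone_set (R : realType) (S : set R) : Prop :=
  uniformly_discrete S /\ relatively_dense S.

Definition supp (R : realType) (c : R -> complex R) : set R :=
  [set u | c u != 0].

Definition delone_configuration (R : realType) (c : R -> complex R) : Prop :=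
  finite_set (range c) /\ delone_set (supp c).

(* Stated with the embedding of int because Num.int needs an archimedean
   structure, which complex R does not carry. *)
Definition integral_fun (R : realType) (c : R -> complex R) : Prop :=
  forall u : R, exists n : int, c u = n%:~R.

Definition annihilator (R : realType) (c f : R -> complex R) : Prop :=
  finite_set (supp f) /\
  forall u : R, \sum_(v \in supp f) f v * c (u - v) = 0.

Definition nontrivial (R : realType) (f : R -> complex R) : Prop :=
  f <> (fun=> 0).

Definition periodic_fun (R : realType) (c : R -> complex R) : Prop :=
  exists2 t : R, t != 0 & forall u : R, c (u - t) = c u.

(* Main.v *)
(* Frobenius: modulo a prime p the p-th power of an integral annihilator f(X)
   is f(X^p), so boundedness of c makes f(X^p) annihilate c for every large p,
   hence f(X^k) for all k = 1 + j m with a fixed m.  Eliminating over this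
   progression shows that a product of binomials 1 - X^s with s > 0
   annihilates c; bounded functions killed by (1 - X^s)^2 are killed by
   1 - X^s, so the s may be taken pairwise incommensurable.  Sparseness of the
   support then forces c(u - ks) to be constant for large k, for each s.  If
   this limit is identically 0, the factor 1 - X^s can be dropped.  Two
   nonzero limits would put tails of progressions with incommensurable steps
   in the support, which then has two points arbitrarily close together. *)

Require Import Defs.
From mathcomp Require Import all_boot all_order all_algebra.
From mathcomp Require Import all_classical all_reals all_analysis.
From mathcomp Require Import finfield complex.
From mathcomp Require Import zify lra.

Set Implicit Arguments.
Unset Strict Implicit.
Unset Printing Implicit Defensive.

Import Order.TTheory GRing.Theory Num.Theory.

Local Open Scope ring_scope.

(** * Frobenius for commuting additive maps, and dilation of integral annihilators *)

Section Frobenius.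
Variables (V : zmodType) (A B : V -> V).
Hypotheses (AD : {morph A : x y / x + y}) (BD : {morph B : x y / x + y}).
Hypothesis AB : forall x, A (B x) = B (A x).

Lemma morph_add0 (F : V -> V) : {morph F : x y / x + y} -> F 0 = 0.
Proof.
by move=> FD; apply: (@addrI _ (F 0)); rewrite -FD !addr0.
Qed.

Lemma morph_addMn (F : V -> V) : {morph F : x y / x + y} ->
  forall n, {morph F : x / x *+ n}.
Proof.
move=> FD n x; elim: n => [|n IHn]; first by rewrite !mulr0n morph_add0.
by rewrite !mulrS FD IHn.
Qed.

(** Pascal's rule: since [A] and [B] commute, the binomial theorem holds for their sum under
    composition. *)
Lemma iter_addE n x :
  iter n (fun y => A y + B y) x =
  \sum_(i < n.+1) iter (n - i) A (iter i B x) *+ 'C(n, i).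
Proof.
have comm k y : iter k A (B y) = B (iter k A y).
  by elim: k => //= k ->.
elim: n => [|n IHn]; first by rewrite big_ord1.
rewrite iterS {}IHn (big_morph _ AD (morph_add0 AD)).
rewrite (big_morph _ BD (morph_add0 BD)).
pose X i := iter (n.+1 - i) A (iter i B x).
rewrite (eq_bigr (fun i : 'I_n.+1 => X i *+ 'C(n, i))) => [|i _]; last first.
  by rewrite (morph_addMn AD) /X subSn // -ltnS.
rewrite [X in _ + X](eq_bigr (fun i : 'I_n.+1 => X i.+1 *+ 'C(n, i))) => [|i _].
  2: by rewrite (morph_addMn BD) /X subSS /= comm.
(* The extra last term has coefficient ['C(n, n.+1)], which is 0; it gives the first sum the length
   that Pascal's rule needs. *)
rewrite [RHS]big_ord_recl /= bin0 [X in X + _ = _](_ : _ =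
  \sum_(i < n.+2) X i *+ 'C(n, i)); last first.
  by rewrite [RHS]big_ord_recr /= (@bin_small n n.+1) // mulr0n addr0.
rewrite big_ord_recl /= bin0 -addrA -big_split /=; congr (_ + _).
by apply: eq_bigr => i _; rewrite /bump /= add1n binS mulrnDr.
Qed.

(** All inner binomial coefficients are divisible by [p], hence vanish on a group of exponent
    [p]. *)
Lemma iter_prime_add p x : prime p -> (forall y : V, y *+ p = 0) ->
  iter p (fun y => A y + B y) x = iter p A x + iter p B x.
Proof.
case: p => [//|q] p_pr Vp.
rewrite iter_addE big_ord_recl big_ord_recr /= bin0 !mulr1n.
rewrite [X in _ + (X + _)]big1 => [|i _].
  by rewrite add0r /bump leq0n add1n subnn binn.
have /dvdnP[k ->] : (q.+1 %| 'C(q.+1, bump 0 i))%N.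
  by apply: prime_dvd_bin => //; rewrite /bump add1n /= ltnS.
by rewrite mulrnA Vp.
Qed.

End Frobenius.

(** Coefficients and shifts are separate families over a list, so that dilation changes [v] only and
    shifts may coincide. *)
Definition convol (R F : pzRingType) (I : Type) (r : seq I) (a : I -> F)
    (v : I -> R) (h : R -> F) : R -> F :=
  fun u => \sum_(i <- r) a i * h (u - v i).

(** Each term commutes with the convolution by the remaining ones, so [p]-th iterates add up term by
    term. A single term iterates to the coefficient [a i ^+ p], which is [a i] in a field with [p]
    elements. *)
Lemma iter_convol (R : pzRingType) (F : finFieldType) (p : nat) (I : Type)
    (r : seq I) (a : I -> F) (v : I -> R) (h : R -> F) :
  #|F| = p -> p \in [pchar F] ->
  iter p (convol r a v) h = convol r a (fun i => v i *+ p) h.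
Proof.
move=> cardF Fp; have p_pr := pcharf_prime Fp.
have char0 (y : R -> F) : y *+ p = 0.
  by apply: funext => u; rewrite natmulfctE -mulr_natr pcharf0 // mulr0.
have cD (r' : seq I) : {morph convol r' a v : x y / x + y}.
  move=> x y; apply: funext => u.
  rewrite -[RHS]/(convol r' a v x u + _) -big_split /=.
  by apply: eq_bigr => i _; rewrite -mulrDr.
elim: r => [|i r IHr].
  apply: funext => u; case: p p_pr {cardF Fp char0} => // n _.
  by rewrite iterS /convol !big_nil.
pose A y := fun u => a i * y (u - v i) : F.
have AD : {morph A : x y / x + y}.
  by move=> x y; apply: funext => u; rewrite -[RHS]/(A x u + A y u) -mulrDr.
have -> : convol (i :: r) a v = (fun y => A y + convol r a v y).
  by apply: funext => y; apply: funext => u; rewrite /convol big_cons.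
rewrite iter_prime_add// => [|y]; last first.
  apply: funext => u; rewrite /A /convol mulr_sumr; apply: eq_bigr => j _.
  by rewrite mulrCA addrAC.
rewrite IHr; apply: funext => u; rewrite /convol big_cons; congr (_ + _).
have -> n y u' : iter n A y u' = a i ^+ n * y (u' - v i *+ n).
  elim: n u' => [|n IHn] u'; first by rewrite mul1r subr0.
  by rewrite iterS {1}/A IHn mulrA -exprS -addrA -opprD -mulrS.
by rewrite -{1}cardF expf_card.
Qed.

(** Modulo [p] the dilated convolution is a [p]-th iterate of one that vanishes, so its values are
    multiples of [p]; they are also smaller than [p] in absolute value. *)
Lemma dilate_annihilator (R : pzRingType) (I : Type) (r : seq I) (a : I -> int)
    (v : I -> R) (h : R -> int) (p N : nat) :
  prime p -> (forall u, `|h u| <= N%:Z) ->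
  \sum_(i <- r) `|a i| * N%:Z < p%:Z ->
  (forall u, convol r a v h u = 0) ->
  forall u, convol r a (fun i => v i *+ p) h u = 0.
Proof.
move=> p_pr hN aNp ann u.
have Fp : p \in [pchar 'F_p] by rewrite pchar_Fp.
pose red (n : int) : 'F_p := n%:~R.
have redE w x : red (convol r a w h x) = convol r (red \o a) w (red \o h) x.
  rewrite /red /convol rmorph_sum; apply: eq_bigr => i _ /=.
  by rewrite rmorphM.
have : red (convol r a (fun i => v i *+ p) h u) = 0.
  rewrite redE -(iter_convol _ _ _ _ (card_Fp p_pr) Fp).
  have iter0 n x : (0 < n)%N ->
      iter n (convol r (red \o a) v) (red \o h) x = 0.
    case: n => // n _; elim: n x => [|n IHn] x; first by rewrite /= -redE ann.
    by rewrite iterS /convol big1 // => i _; rewrite IHn mulr0.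
  by rewrite iter0 // prime_gt0.
move/eqP; rewrite /red -(dvdz_pcharf Fp) => /dvdzP[q Eq].
have : `|convol r a (fun i => v i *+ p) h u| < p%:Z.
  apply: le_lt_trans aNp; apply: le_trans (ler_norm_sum _ _ _) _.
  by apply: ler_sum => i _; rewrite normrM ler_wpM2l.
rewrite Eq; case: (eqVneq q 0) => [->|q0]; first by rewrite mul0r.
have p0 := prime_gt0 p_pr.
rewrite normrM => Hlt; exfalso.
have : 1 <= `|q| by lia.
by nia.
Qed.

(* The modulus is [m = B!] with [B] bounding [\sum_i |a i| * N], so that every
   prime factor of [1 + j * m] exceeds [B]. *)
Lemma dilate_annihilator_progression (R : pzRingType) (I : Type) (r : seq I)
    (a : I -> int) (v : I -> R) (h : R -> int) (N : nat) :
  (forall u, `|h u| <= N%:Z) -> (forall u, convol r a v h u = 0) ->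
  exists2 m : nat, (0 < m)%N &
    forall j u, convol r a (fun i => v i *+ (j * m).+1) h u = 0.
Proof.
move=> hN ann.
have [B aB] : exists B : nat, \sum_(i <- r) `|a i| * N%:Z <= B%:Z.
  exists (absz (\sum_(i <- r) `|a i| * N%:Z)).
  by rewrite abszE ler_norm.
exists B`! => [|j]; first exact: fact_gt0.
have: forall q, prime q -> (q %| (j * B`!).+1)%N -> (B < q)%N.
  move=> q q_pr dvq; rewrite ltnNge; apply/negP => qB.
  have : (q %| 1)%N.
    rewrite -(dvdn_addr _ (_ : q %| j * B`!)%N) ?addn1 //.
    by rewrite dvdn_mull // dvdn_fact // prime_gt0.
  by rewrite dvdn1 => /eqP q1; rewrite q1 in q_pr.
have : (0 < (j * B`!).+1)%N by [].
(* Of the dilation factor only the bound on its prime factors is kept; the induction splits off one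
   prime [p] and dilates the annihilator already dilated by [l]. *)
elim/ltn_ind: (j * B`!).+1 => {j} k IHk k0 kB u.
case: (leqP k 1) => [k1|k1].
  have -> : k = 1%N by lia.
  exact: ann.
have /dvdnP[l kE] := pdiv_dvd k; have p_pr := pdiv_prime k1.
set p := pdiv k in kE p_pr *.
have -> : (fun i => v i *+ k) = (fun i => v i *+ l *+ p).
  by apply: funext => i; rewrite kE mulrnA.
have l0 : (0 < l)%N by nia.
apply: (dilate_annihilator p_pr hN).
  by apply: le_lt_trans aB _; rewrite ltz_nat; apply: kB => //; apply: pdiv_dvd.
apply: IHk => //; first by have := prime_gt1 p_pr; nia.
by move=> q q_pr ql; apply: kB => //; rewrite kE dvdn_mulr.
Qed.

(** * Backward differences and limits along progressions *)

Section Differences.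
Variables (R V : zmodType).
Implicit Types (s t u : R) (l : seq R) (g h : R -> V).

(** Multiplication by the binomial 1 - X^s, where X^s shifts by [s]; [bdiffs] is a product of such
    binomials. *)
Definition bdiff s h : R -> V := fun u => h u - h (u - s).

Definition bdiffs l h : R -> V := foldl (fun g s => bdiff s g) h l.

Lemma bdiff0 s : bdiff s 0 = 0.
Proof. by apply: funext => u; rewrite /bdiff subr0. Qed.

Lemma bdiffs0 l : bdiffs l 0 = 0.
Proof. by elim: l => //= s l IHl; rewrite bdiff0. Qed.

Lemma bdiffC s t h : bdiff s (bdiff t h) = bdiff t (bdiff s h).
Proof.
by apply: funext => u; rewrite /bdiff (addrAC u (- s)) !opprD addrACA.
Qed.

Lemma bdiffB s g h : bdiff s (g - h) = bdiff s g - bdiff s h.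
Proof.
apply: funext => u.
rewrite -[LHS]/((g u - h u) - (g (u - s) - h (u - s))).
rewrite -[RHS]/((g u - g (u - s)) - (h u - h (u - s))).
by rewrite !opprD addrACA.
Qed.

Lemma bdiffsB l g h : bdiffs l (g - h) = bdiffs l g - bdiffs l h.
Proof. by elim: l g h => //= s l IHl g h; rewrite bdiffB IHl. Qed.

Lemma bdiffs_bdiff l s h : bdiffs l (bdiff s h) = bdiff s (bdiffs l h).
Proof. by elim: l h => //= t l IHl h; rewrite bdiffC IHl. Qed.

Lemma bdiffs_perm l1 l2 h : perm_eq l1 l2 -> bdiffs l1 h = bdiffs l2 h.
Proof.
have catE l l' k : bdiffs (l ++ l') k = bdiffs l' (bdiffs l k).
  by rewrite /bdiffs foldl_cat.
have catC l l' k : bdiffs (l ++ l') k = bdiffs (l' ++ l) k.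
  elim: l k => [|s l IHl] k; first by rewrite cats0.
  by rewrite /= IHl !catE /= bdiffs_bdiff.
move=> l12; pose P l := bdiffs l h = bdiffs l2 h.
rewrite perm_sym in l12.
refine (@catCA_perm_ind _ P _ l2 l1 l12 erefl).
by rewrite /P => s1 s2 s3 <-; rewrite !catA !(catE (_ ++ _)) catC.
Qed.

Lemma bdiff_eq0_shift s h : bdiff s h = 0 -> forall u n, h (u - s *+ n) = h u.
Proof.
move=> sh u; elim=> [|n IHn]; first by rewrite subr0.
rewrite -[RHS]IHn mulrSr opprD addrA; apply/esym/eqP; rewrite -subr_eq0.
by have /(congr1 (fun k => k (u - s *+ n))) := sh; rewrite /bdiff => ->.
Qed.

Lemma bdiff_eq0_mul s h n : bdiff s h = 0 -> bdiff (s *+ n) h = 0.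
Proof.
by move=> sh; apply: funext => u; rewrite /bdiff bdiff_eq0_shift ?subrr.
Qed.

(** The identities for [j.+1] at [u] and for [j] at [u - sg i] contain the same term in [H i]. Their
    difference is an identity of the same shape without [i], with [h] replaced by
    [bdiff (sg i) h]. *)
Lemma eliminate_progression (I : Type) (r : seq I) (sg : I -> R)
    (H : I -> R -> V) h :
  (forall j u, h u + \sum_(i <- r) H i (u - sg i *+ j) = 0) ->
  bdiffs [seq sg i | i <- r] h = 0.
Proof.
elim: r h H => [|i r IHr] h H eqH /=.
  by apply: funext => u; have := eqH 0 u; rewrite big_nil addr0.
apply: (IHr _ (fun k u => H k (u - sg k) - H k (u - sg i))) => j u.
have := eqH j (u - sg i); have := eqH j.+1 u.
rewrite !big_cons => E1 E2; rewrite sumrB /bdiff addrACA -opprD.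
rewrite mulrS opprD addrA in E1.
apply/eqP; rewrite subr_eq0; apply/eqP.
apply: (@addIr _ (H i (u - sg i - sg i *+ j))).
rewrite 2!(addrAC _ (\sum_(_ <- _) _)); rewrite !addrA in E1 E2.
transitivity (0 : V).
  rewrite -[RHS]E1; congr (_ + _); apply: eq_bigr => k _.
  by rewrite mulrS opprD addrA [u - _ - sg k]addrAC.
by rewrite -[LHS]E2; congr (_ + _); apply: eq_bigr => k _; rewrite addrAC.
Qed.

Definition eventually0 s h :=
  forall u, exists K, forall k, (K <= k)%N -> h (u - s *+ k) = 0.

Lemma eventually0_bdiff s t h : eventually0 s h -> eventually0 s (bdiff t h).
Proof.
move=> sh u; have [K hK] := sh u; have [K' hK'] := sh (u - t).
exists (maxn K K') => k; rewrite geq_max => /andP[Kk K'k].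
by rewrite /bdiff hK // addrAC hK' // subr0.
Qed.

Lemma eventually0_bdiffs s l h : eventually0 s h -> eventually0 s (bdiffs l h).
Proof. by elim: l h => //= t l IHl h /(@eventually0_bdiff s t)/IHl. Qed.

Lemma eventually0_bdiff_eq0 s h : eventually0 s h -> bdiff s h = 0 -> h = 0.
Proof.
move=> s0 sh; apply: funext => u; have [K hK] := s0 u.
by rewrite -(bdiff_eq0_shift sh u K) hK.
Qed.

Lemma eventually0D s g h :
  eventually0 s g -> eventually0 s h -> eventually0 s (g + h).
Proof.
move=> sg sh u; have [K hK] := sg u; have [K' hK'] := sh u.
exists (maxn K K') => k; rewrite geq_max => /andP[Kk K'k].
by rewrite -[LHS]/(g _ + h _) hK // hK' // addr0.
Qed.

Definition limit_along s h g :=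
  forall u, exists K, forall k, (K <= k)%N -> h (u - s *+ k) = g u.

Lemma limit_alongP s h : eventually0 s (bdiff s h) -> exists g, limit_along s h g.
Proof.
move=> s0; have : forall u, exists x K,
    forall k, (K <= k)%N -> h (u - s *+ k) = x.
  move=> u; have [K hK] := s0 u; exists (h (u - s *+ K)), K => k /subnK <-.
  elim: (k - K)%N => // n <-; rewrite addSn mulrSr opprD addrA.
  by apply/esym/eqP; rewrite -subr_eq0 -/(bdiff s h _) hK // leq_addl.
by move=> /boolp.choice[g hg]; exists g.
Qed.

Lemma limit_along_bdiff s h g : limit_along s h g -> bdiff s g = 0.
Proof.
move=> lim; apply: funext => u; have [K hK] := lim u.
have [K' hK'] := lim (u - s); rewrite /bdiff.
(* Index [k.+1] from [u] and index [k] from [u - s] give the same point. *)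
rewrite -(hK (maxn K K').+1) ?leqW ?leq_maxl//.
by rewrite -(hK' (maxn K K')) ?leq_maxr// mulrS opprD addrA subrr.
Qed.

Lemma limit_along_sub s h g : limit_along s h g -> eventually0 s (h - g).
Proof.
move=> lim u; have [K hK] := lim u; exists K => k Kk.
rewrite -[LHS]/(h _ - g _) hK // (bdiff_eq0_shift (limit_along_bdiff lim)).
by rewrite subrr.
Qed.

(** The function [bdiffs l (h - g)] is killed by [bdiff s], so it is constant along progressions of
    step [s], on which it is eventually 0. For [g = 0] this drops the factor [s]. *)
Lemma bdiffs_sub_limit s l h g :
  limit_along s h g -> bdiffs (s :: l) h = 0 -> bdiffs l (h - g) = 0.
Proof.
move=> lim slh; apply: (@eventually0_bdiff_eq0 s).
  exact/eventually0_bdiffs/limit_along_sub.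
rewrite -bdiffs_bdiff bdiffB (limit_along_bdiff lim) bdiffsB bdiffs0 subr0.
exact: slh.
Qed.

End Differences.

(** * Sparse supports on the real line and incommensurable steps *)

Section RealSupports.
Variable R : realType.
Implicit Types (e s t u x T : R).

(** Pigeonhole: cut the window into cells of length [e]; each holds at most one point. *)
Lemma separated_size (T e : R) : 0 < e -> exists M : nat, forall x (l : seq R),
  uniq l -> (forall y, y \in l -> x <= y <= x + T) ->
  (forall y z, y \in l -> z \in l -> `|y - z| < e -> y = z) -> (size l <= M)%N.
Proof.
move=> e0; exists (Num.truncn (T / e)).+1 => x l ul lxT sep.
pose cell y := Num.truncn ((y - x) / e).
have cellP y : y \in l -> (cell y)%:R * e <= y - x < (cell y).+1%:R * e.
  move=> /lxT/andP[xy _]; rewrite -ler_pdivlMr// -ltr_pdivrMr//.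
  by apply: truncn_itv; rewrite divr_ge0 ?subr_ge0 // ltW.
rewrite -(size_map cell) -(size_iota 0 (Num.truncn (T / e)).+1).
apply: uniq_leq_size => [|_ /mapP[y yl ->]].
  rewrite map_inj_in_uniq // => y z yl zl yz; apply: sep => //.
  have := cellP _ yl; have := cellP _ zl; rewrite yz -natr1 mulrDl mul1r.
  move=> /andP[z1 z2] /andP[y1 y2]; rewrite ltr_norml.
  by apply/andP; split; lra.
rewrite mem_iota /= add0n ltnS; apply: le_truncn.
by rewrite ler_pM2r ?invr_gt0// lerBlDl; case/andP: (lxT _ yl).
Qed.

(** Counting support points in windows, rather than separating them, gives a notion that passes to
    differences, as uniform discreteness does not. *)
Definition uniformly_sparse (V : zmodType) (h : R -> V) :=
  forall T, exists M : nat, forall x (l : seq R), uniq l ->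
  (forall y, y \in l -> h y != 0 /\ x <= y <= x + T) -> (size l <= M)%N.

Section Sparse.
Variable V : zmodType.
Implicit Types (g h : R -> V) (l : seq R).

Lemma uniformly_discrete_sparse h :
  uniformly_discrete [set u | h u != 0]%classic -> uniformly_sparse h.
Proof.
move=> [r r0 dsc] T; have [M sepM] := separated_size T r0.
exists M => x l ul lP; apply: (sepM x) => // [y /lP[]//|y z yl zl yz].
have [hy _] := lP _ yl; have [hz _] := lP _ zl.
apply: (dsc z); split=> //=; rewrite in_itv /=; last by apply/andP; split; lra.
by move: yz; rewrite ltr_norml => /andP[? ?]; apply/andP; split; lra.
Qed.

Lemma uniformly_sparse_shift h s :
  uniformly_sparse h -> uniformly_sparse (fun u => h (u - s)).
Proof.
move=> sp T; have [M hM] := sp T; exists M => x l ul lP.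
rewrite -(size_map (fun y => y - s)); apply: (hM (x - s)).
  by rewrite map_inj_uniq //; apply: addIr.
move=> _ /mapP[y /lP[hy /andP[y1 y2]] ->]; split=> //.
by apply/andP; split; lra.
Qed.

Lemma uniformly_sparseB g h :
  uniformly_sparse g -> uniformly_sparse h -> uniformly_sparse (g - h).
Proof.
move=> sg sh T; have [M gM] := sg T; have [M' hM] := sh T.
exists (M + M')%N => x l ul lP.
rewrite -(count_predC (fun y => g y != 0)) -!size_filter leq_add//.
  apply: (gM x) => [|y]; rewrite ?filter_uniq// mem_filter.
  by case/andP=> gy /lP[].
apply: (hM x) => [|y]; rewrite ?filter_uniq// mem_filter /= negbK.
case/andP=> /eqP gy /lP[]; rewrite -[(g - h) y]/(g y - h y) gy.
by rewrite sub0r oppr_eq0.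
Qed.

Lemma uniformly_sparse_bdiff h s :
  uniformly_sparse h -> uniformly_sparse (bdiff s h).
Proof.
move=> sh; apply: uniformly_sparseB => //; exact: uniformly_sparse_shift.
Qed.

(** A finite set of support points of [g], translated far enough by one common multiple of [s], lies
    in the support of [h]. *)
Lemma uniformly_sparse_limit s h g :
  limit_along s h g -> uniformly_sparse h -> uniformly_sparse g.
Proof.
move=> lim sh T; have [M hM] := sh T; exists M => x l ul lP.
have [K hK] : exists K, forall y, y \in l -> h (y - s *+ K) = g y.
  suff [K hK] : exists K, forall k, (K <= k)%N ->
      forall y, y \in l -> h (y - s *+ k) = g y.
    by exists K; apply: hK.
  elim: l {ul lP} => [|y l [K hK]]; first by exists 0.
  have [K' hK'] := lim y; exists (maxn K K') => k.
  rewrite geq_max => /andP[Kk K'k] z; rewrite inE => /predU1P[->|zl].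
    exact: hK'.
  exact: hK.
rewrite -(size_map (fun y => y - s *+ K)); apply: (hM (x - s *+ K)).
  by rewrite map_inj_uniq //; apply: addIr.
move=> _ /mapP[y yl ->]; have [gy /andP[y1 y2]] := lP _ yl.
by rewrite hK //; split=> //; apply/andP; split; lra.
Qed.

Definition incommensurable s t :=
  forall a b : int, s *~ a = t *~ b -> a = 0 /\ b = 0.

Lemma incommensurable_sym s t : incommensurable s t -> incommensurable t s.
Proof. by move=> st a b /esym/st[]. Qed.

Lemma bdiff_eq0_shiftz t g : bdiff t g = 0 -> forall u (n : int),
  g (u - t *~ n) = g u.
Proof.
move=> tg u [n|n]; first exact: bdiff_eq0_shift.
rewrite NegzE mulrNz -(bdiff_eq0_shift tg _ n.+1).
by rewrite opprK addrK.
Qed.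

Definition residue t u := u - t *~ Num.floor (u / t).

(** The upper bound is written [0 + t] to fit the windows of [uniformly_sparse] and [separated_size]
    at [x = 0]. *)
Lemma residue_itv t u : 0 < t -> 0 <= residue t u <= 0 + t.
Proof.
move=> t0; have /andP[f1 f2] := floor_itv (u / t).
rewrite ler_pdivlMr// in f1; rewrite ltr_pdivrMr// intrD mulrDl mul1r in f2.
rewrite /residue -mulrzl add0r; apply/andP; split; lra.
Qed.

Lemma residue_inj s t u : incommensurable s t ->
  injective (fun k : nat => residue t (u - s *+ k)).
Proof.
move=> st k k' E.
have /st[/eqP] : s *~ (k'%:Z - k%:Z) = t *~ (Num.floor ((u - s *+ k) / t)
    - Num.floor ((u - s *+ k') / t)).
  rewrite !mulrzBr; move: E; rewrite /residue -!pmulrn.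
  move: (Num.floor _) (Num.floor _) => a b; lra.
by rewrite subr_eq0 => /eqP[].
Qed.

(** Otherwise infinitely many points [u - s *+ k] lie in the support. By [t]-periodicity so do their
    residues modulo [t], which are distinct and crowd a single window of length [t]. *)
Lemma periodic_sparse_eventually0 s t g : 0 < t -> incommensurable s t ->
  bdiff t g = 0 -> uniformly_sparse g -> eventually0 s g.
Proof.
move=> t0 st tg sg u; apply: contrapT => nev.
have io K : exists2 k, (K <= k)%N & g (u - s *+ k) != 0.
  apply: contrapT => nK; apply: nev; exists K => k Kk.
  by apply/eqP; apply: contrapT => /negP gk; apply: nK; exists k.
have io_seq n : exists l : seq nat,
    [/\ uniq l, size l = n & forall k, k \in l -> g (u - s *+ k) != 0].
  elim: n => [|n [l [ul <- lP]]]; first by exists [::].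
  (* The chosen lower bound exceeds every index in [l], so [k] is new. *)
  have [k lk gk] := io (\max_(i <- l) i.+1); exists (k :: l); split=> //=.
    rewrite ul andbT; apply/negP => kl; move: lk; rewrite leqNgt.
    by rewrite (leq_bigmax_seq k).
  by move=> j; rewrite inE => /predU1P[->//|/lP].
have [M gM] := sg t; have [l [ul sl lP]] := io_seq M.+1.
suff : (M < M)%N by rewrite ltnn.
rewrite -{1}sl -(size_map (fun k : nat => residue t (u - s *+ k))).
apply: (gM 0); first by rewrite map_inj_uniq //; exact: residue_inj.
move=> _ /mapP[k kl ->]; split; last exact: residue_itv.
by rewrite /residue bdiff_eq0_shiftz // lP.
Qed.

Fixpoint pairwise_incommensurable l : Prop :=
  if l is s :: l' then
    (forall t, t \in l' -> incommensurable s t) /\ pairwise_incommensurable l'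
  else True.

(** Induction on [l], used twice. With [t] for [s] it applies to [bdiff t h] and yields a limit [g]
    of [h] along [t]. Then [h - g] is killed by the shorter list, hence eventually 0 along [s], and
    so is [g], being [t]-periodic and sparse. *)
Lemma bdiffs_eventually0 l s h :
  (forall t, t \in l -> 0 < t /\ incommensurable s t) ->
  pairwise_incommensurable l -> uniformly_sparse h -> bdiffs l h = 0 ->
  eventually0 s h.
Proof.
elim: l s h => [|t l IHl] s h sl pl sh lh.
  by move=> u; exists 0 => k _; rewrite -[h]/(bdiffs [::] h) lh.
have [t0 st] := sl t (mem_head _ _); have [tl {}pl] := pl.
have sl' r : r \in l -> 0 < r /\ incommensurable s r.
  by move=> rl; apply: sl; rewrite inE rl orbT.
have [|g lim] := @limit_alongP _ _ t h.
  apply: IHl => //; last exact: uniformly_sparse_bdiff.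
  by move=> r rl; split; [case: (sl' r rl)|exact: tl].
have sg := uniformly_sparse_limit lim sh.
rewrite -(subrK g h); apply: eventually0D.
  apply: IHl => //; first exact: uniformly_sparseB.
  exact: bdiffs_sub_limit lim lh.
apply: (periodic_sparse_eventually0 t0) => //.
exact: limit_along_bdiff lim.
Qed.

End Sparse.

(** Pigeonhole on the residues modulo [t] of multiples of [- s]: infinitely many distinct points in
    a bounded window cannot all be [e] apart. *)
Lemma small_combination s t e : 0 < s -> 0 < t -> incommensurable s t -> 0 < e ->
  exists a b : nat, 0 < `|s *+ a - t *+ b| < e.
Proof.
move=> s0 t0 st e0; have [M sepM] := separated_size t e0.
pose f (k : nat) := residue t (0 - s *+ k).
have finj : injective f by apply: residue_inj.
apply: contrapT => no.
suff : (M < M)%N by rewrite ltnn.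
rewrite -{1}(size_iota 0 M.+1) -(size_map f); apply: (sepM 0).
- by rewrite map_inj_uniq ?iota_uniq.
- by move=> _ /mapP[k _ ->]; exact: residue_itv.
move=> _ _ /mapP[k _ ->] /mapP[k' _ ->] lte; apply: contrapT => neq.
wlog kk' : k k' lte neq / (k <= k')%N.
  move=> W; have /orP[|] := leq_total k k'; first exact: W.
  by apply: W; [rewrite distrC|move/esym].
(* Monotonicity of the floor makes the coefficient of [t] non-negative too. *)
have fl : Num.floor ((0 - s *+ k') / t) <= Num.floor ((0 - s *+ k) / t).
  apply: le_floor; rewrite ler_pM2r ?invr_gt0// !sub0r lerN2.
  by rewrite ler_wpMn2l // ltW.
pose n := Num.floor ((0 - s *+ k) / t) - Num.floor ((0 - s *+ k') / t).
case: no; exists (k' - k)%N, (absz n).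
have -> : s *+ (k' - k) - t *+ absz n = f k - f k'.
  rewrite mulrnBr // [t *+ _]pmulrn gez0_abs ?subr_ge0 // /n mulrzBr /f /residue.
  move: (Num.floor _) (Num.floor _) => p q; lra.
by rewrite lte normr_gt0 subr_eq0 andbT; apply/eqP.
Qed.

(** Advancing the two indices by [a] and [b] lowers the gap between the points by a fixed [d] with
    [0 < d < e]; a non-negative gap is thus brought below [d]. *)
Lemma near_collision s t e u u' (K K' : nat) :
  0 < s -> 0 < t -> incommensurable s t -> 0 < e ->
  exists k k', [/\ (K <= k)%N, (K' <= k')%N &
    0 < `|(u - s *+ k) - (u' - t *+ k')| < e].
Proof.
move=> s0 t0 st e0; have [a [b /andP[d0 de]]] := small_combination s0 t0 st e0.
(* Exchanging the two progressions changes the sign of [d]. *)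
wlog dpos : s t u u' K K' a b s0 t0 st d0 de / 0 < s *+ a - t *+ b.
  move=> W; have [|dneg] := ltP 0 (s *+ a - t *+ b); first exact: (W).
  have [||||||k [k' [Kk K'k' kk']]] := W t s u' u K' K b a => //.
  - exact: incommensurable_sym.
  - by rewrite distrC.
  - by rewrite distrC.
  - move: d0; rewrite normr_gt0 subr_gt0 subr_eq0 lt_neqAle -subr_le0 dneg.
    by rewrite andbT.
  by exists k', k; split=> //; rewrite distrC.
set d := s *+ a - t *+ b in d0 de dpos.
(* Large enough to put the second starting point below the first, so that the initial gap [D] is
   non-negative. *)
pose K2 := (K' + (Num.truncn (`|u - s *+ K - u'| / t)%R).+1)%N.
pose D := (u - s *+ K) - (u' - t *+ K2).
have D0 : 0 <= D.
  have /andP[_] := @truncn_itv _ (`|u - s *+ K - u'| / t)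
    (divr_ge0 (normr_ge0 _) (ltW t0)).
  rewrite ltr_pdivrMr // => lt1.
  have lt2 : `|u - s *+ K - u'| < t *+ K2.
    rewrite -[t *+ K2]mulr_natl; apply: lt_le_trans lt1 _.
    by rewrite ler_pM2r // ler_nat leq_addl.
  have := ler_norm (- (u - s *+ K - u')); rewrite normrN /D => lt3.
  move: (t *+ K2) lt2 lt3 => *; lra.
pose j := Num.truncn (D / d).
have /andP[j1 j2] := @truncn_itv _ (D / d) (divr_ge0 D0 (ltW dpos)).
rewrite ler_pdivlMr // in j1; rewrite ltr_pdivrMr // -natr1 mulrDl mul1r in j2.
have E i : (u - s *+ (K + i * a)) - (u' - t *+ (K2 + i * b)) = D - i%:R * d.
  have M x c : x *+ (i * c) = i%:R * (x *+ c) by rewrite mulnC mulrnA mulr_natl.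
  rewrite /D /d !mulrnDr !M mulrBr.
  by move: (t *+ K2) (s *+ K) => *; lra.
rewrite gtr0_norm // in de.
have K'K i : (K' <= K2 + i)%N by rewrite /K2 -addnA leq_addr.
(* If the points coincide exactly, one more step gives the gap [- d], which is non-zero. *)
have [D1|D1] := eqVneq (D - j%:R * d) 0.
  exists (K + j.+1 * a)%N, (K2 + j.+1 * b)%N; split=> //.
    exact: leq_addr.
  rewrite E -natr1 mulrDl mul1r opprD addrA D1 sub0r normrN gtr0_norm //.
  exact/andP.
exists (K + j * a)%N, (K2 + j * b)%N; split=> //; first exact: leq_addr.
rewrite E normr_gt0 D1 /= ger0_norm ?subr_ge0//.
by rewrite /j; lra.
Qed.

End RealSupports.

(** * Bounded integer-valued functions killed by a product of binomials *)

Section IntegerValued.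
Variable R : realType.
Implicit Types (h : R -> int) (s t u : R) (l : seq R).

Definition bounded_values h := exists N : nat, forall u, `|h u| <= N%:Z.

Lemma bounded_values_bdiffs l h : bounded_values h -> bounded_values (bdiffs l h).
Proof.
elim: l h => //= s l IHl h [N hN]; apply: IHl; exists (N + N)%N => u.
by apply: le_trans (ler_normB _ _) _; rewrite PoszD lerD.
Qed.

(** A vanishing second difference makes [h] affine along progressions of step [s]. A non-zero
    integer slope would change [h] by more than [N + N] within [(N + N).+1] steps. *)
Lemma bdiff_idem_eq0 s h : bounded_values h -> bdiff s (bdiff s h) = 0 ->
  bdiff s h = 0.
Proof.
move=> [N hN] ssh; apply: funext => u.
have lin n : h u - h (u - s *+ n) = bdiff s h u * n%:Z.
  elim: n => [|n IHn]; first by rewrite subr0 subrr mulr0.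
  rewrite -addn1 PoszD mulrDr mulr1 -IHn -(bdiff_eq0_shift ssh u n) /bdiff.
  by rewrite addn1 mulrSr opprD !addrA subrK.
rewrite -[RHS]/(0 : int).
have := lin (N + N).+1; have := hN u; have := hN (u - s *+ (N + N).+1).
move: (h u) (h _) (bdiff s h u) => x y z hx hy E.
have : `|z * (N + N).+1%:Z| <= (N + N)%:Z by rewrite -E; lia.
rewrite normrM => le1; apply/eqP; apply: contraT => z0.
have : 1 <= `|z| by lia.
nia.
Qed.

Lemma not_incommensurable s t : 0 < s -> 0 < t -> ~ incommensurable s t ->
  exists p q : nat, [/\ (0 < p)%N, (0 < q)%N & s *+ p = t *+ q].
Proof.
move=> s0 t0 nst; have [a [b [E nab]]] : exists a b : int,
    s *~ a = t *~ b /\ ~ (a = 0 /\ b = 0).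
  apply: contrapT => no; apply: nst => a b E; apply: contrapT => nab.
  by apply: no; exists a, b.
have a0 : a != 0.
  apply/eqP => a0; apply: nab; split=> //; apply/eqP; move/eqP: E.
  by rewrite a0 mulr0z eq_sym mulrz_eq0 [X in _ || X]gt_eqF // orbF.
have b0 : b != 0.
  apply/eqP => b0; apply: nab; split=> //; apply/eqP; move/eqP: E.
  by rewrite b0 mulr0z mulrz_eq0 [X in _ || X]gt_eqF // orbF.
exists (absz a), (absz b); split; rewrite ?absz_gt0 //.
(* Taking absolute values on both sides of the relation makes the coefficients natural numbers. *)
have absE x (n : int) : 0 < x -> x *+ absz n = `|x *~ n|.
  by move=> x0; rewrite normrMz (gtr0_norm x0) -abszE pmulrn.
by rewrite !absE // E.
Qed.

Lemma commensurable_pair l : ~ pairwise_incommensurable l ->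
  exists s t l', perm_eq l [:: s, t & l'] /\ ~ incommensurable s t.
Proof.
elim: l => [|s l IHl] nl; first by case: nl.
have [sl|] := pselect (forall t, t \in l -> incommensurable s t).
  have [|s' [t' [l' [ll' st']]]] := IHl; first by move=> pl; apply: nl.
  exists s', t', (s :: l'); split=> //.
  rewrite -(perm_cons s) in ll'; apply: perm_trans ll' _.
  by apply/permP => p /=; lia.
move/existsNP => [t /not_implyP[tl nst]].
by exists s, t, (rem t l); rewrite perm_cons perm_to_rem.
Qed.

(** Induction on a bound for the number of factors: commensurable factors are merged, factors with
    zero limit are dropped, and two non-zero limits are contradictory. *)
Lemma bdiffs_eq0_periodic l h :
  uniformly_discrete [set u | h u != 0]%classic -> bounded_values h ->
  (forall s, s \in l -> 0 < s) -> bdiffs l h = 0 ->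
  exists2 s, 0 < s & bdiff s h = 0.
Proof.
move=> dsc bh; have sh := uniformly_discrete_sparse dsc.
move: {2}(size l) (leqnn (size l)) => n.
elim: n l => [|n IHn] [|s [|t l]] //=.
(* An empty product kills only [h = 0], for which 1 serves as a period. *)
- by move=> _ _ hE; exists 1; rewrite ?ltr01 // -[h]/(bdiffs [::] h) hE bdiff0.
- by move=> _ _ hE; exists 1; rewrite ?ltr01 // -[h]/(bdiffs [::] h) hE bdiff0.
- by move=> _ l0 sE; exists s => //; apply: l0; rewrite mem_head.
move=> sl l0 E; have [pl|/commensurable_pair] :=
    pselect (pairwise_incommensurable [:: s, t & l]); last first.
  move=> [s' [t' [l' [ll' nst]]]].
  have pos r : r \in [:: s', t' & l'] -> 0 < r.
    by rewrite -(perm_mem ll'); apply: l0.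
  have s'0 : 0 < s' by apply: pos; rewrite !inE eqxx.
  have t'0 : 0 < t' by apply: pos; rewrite !inE eqxx orbT.
  have [p [q [p0 q0 pq]]] := not_incommensurable s'0 t'0 nst.
  (* The common multiple [s' *+ p] replaces both [s'] and [t']: its binomial is a multiple of each
     of theirs, so its square kills [bdiffs l' h], and boundedness removes the square. *)
  apply: (IHn (s' *+ p :: l')).
  - by have := perm_size ll'; rewrite /= => -[sz]; move: sl; rewrite sz.
  - move=> r; rewrite inE => /predU1P[->|rl]; first by rewrite pmulrn_lgt0.
    by apply: pos; rewrite !inE rl !orbT.
  rewrite /= bdiffs_bdiff; apply: bdiff_idem_eq0.
    exact: bounded_values_bdiffs.
  rewrite {1}pq bdiff_eq0_mul // bdiffC bdiff_eq0_mul // bdiffC.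
  have := bdiffs_perm h ll'; by rewrite [LHS]E /= !bdiffs_bdiff => <-.
(* Stated for any [r] brought to the head, as it is applied to both [s] and [t]. The second
   alternative is a non-zero limit along [r]. *)
have drop r r' l' : perm_eq [:: s, t & l] [:: r, r' & l'] ->
    (forall t', t' \in r' :: l' -> incommensurable r t') ->
    pairwise_incommensurable (r' :: l') ->
    (exists2 s, 0 < s & bdiff s h = 0) \/
    exists u K, forall k, (K <= k)%N -> h (u - r *+ k) != 0.
  move=> perm rl' pl'.
  have pos x : x \in [:: r, r' & l'] -> 0 < x.
    by rewrite -(perm_mem perm); apply: l0.
  have rE : bdiffs [:: r, r' & l'] h = 0 by rewrite -(bdiffs_perm h perm) -E.
  have pos' x : x \in r' :: l' -> 0 < x.
    by move=> xl; apply: pos; rewrite inE xl orbT.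
  have [|g lim] := @limit_alongP _ _ r h.
    apply: (@bdiffs_eventually0 _ _ (r' :: l')) => //.
    - by move=> x xl; split; [exact: pos'|exact: rl'].
    - exact: uniformly_sparse_bdiff.
  have [g0|/eqP gn0] := eqVneq g 0.
    left; apply: (IHn (r' :: l')) => //.
      by have := perm_size perm => -[sz]; move: sl; rewrite /= sz.
    by have := bdiffs_sub_limit lim rE; rewrite g0 subr0.
  right; have [u gu] : exists u, g u <> 0.
    by apply: contrapT => /forallNP gu; apply: gn0; apply: funext => u;
      apply: contrapT.
  by exists u; have [K hK] := lim u; exists K => k /hK ->; apply/eqP.
have st := pl.1 t (mem_head _ _); have [sl' [tl pl']] := pl.
have [//|[u [K hK]]] := drop s t l (perm_refl _) pl.1 pl.2.
have swap : perm_eq [:: s, t & l] [:: t, s & l].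
  by apply/permP => p /=; lia.
have [||//|[u' [K' hK']]] := drop t s l swap.
- move=> x; rewrite inE => /predU1P[->|]; last exact: tl.
  exact: incommensurable_sym.
- by split=> // x xl; apply: sl'; rewrite inE xl orbT.
(* The tails along [s] and [t] both lie in the support, and contain distinct points closer than the
   separation radius. *)
have [r r0 rP] := dsc; exfalso.
have s0 : 0 < s by apply: l0; rewrite !inE eqxx.
have t0 : 0 < t by apply: l0; rewrite !inE eqxx orbT.
have [k [k' [Kk K'k' /andP[]]]] := near_collision u u' K K' s0 t0 st r0.
rewrite normr_gt0 subr_eq0 => /eqP neq; rewrite ltr_norml => /andP[lt1 lt2].
apply: neq; apply: (rP (u' - t *+ k')); split=> /=.
- exact: hK.
- by rewrite in_itv /=; apply/andP; split; lra.
- exact: hK'.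
- by rewrite in_itv /=; apply/andP; split; lra.
Qed.

End IntegerValued.

(** * From complex configurations to integer functions, and the conclusion *)

Lemma finite_range_bounded (R : realType) (c : R -> complex R) (h : R -> int) :
  (forall u, c u = (h u)%:~R) -> finite_set (range c) -> bounded_values h.
Proof.
move=> ch /finite_seqP[r cr].
have [N hN] : exists N : nat, forall u, c u \in r -> `|h u| <= N%:Z.
  elim: r {cr} => [|z r [N hN]]; first by exists 0%N.
  have [[u0 cz]|nz] := pselect (exists u, c u = z).
    exists (N + absz (h u0))%N => u; rewrite inE => /predU1P[cuz|/hN]; last by lia.
    have -> : h u = h u0 by apply: (@intr_inj (complex R)); rewrite -!ch cuz cz.
    by lia.
  by exists N => u; rewrite inE => /predU1P[cuz|/hN//]; case: nz; exists u.
by exists N => u; apply: hN; have : range c (c u) by []; rewrite cr.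
Qed.

(** Moving the least support point [v0] of the annihilator to the origin turns its dilation by
    [(j * m).+1] into shifts [(v - v0) + j * m * (v - v0)], a progression in [j] from which all
    terms but the one at [v0] are eliminated. *)
Lemma annihilator_bdiffs (R : realType) (c f : R -> complex R) :
  finite_set (range c) -> integral_fun c ->
  annihilator c f -> integral_fun f -> nontrivial f ->
  exists l (h : R -> int), [/\ forall s, s \in l -> 0 < s, bounded_values h,
    exists2 n : int, n != 0 & forall u, (h u)%:~R = n%:~R * c u
    & bdiffs l h = 0].
Proof.
move=> c_fin /boolp.choice[h ch] [f_fin ann] /boolp.choice[a fa] f_nz.
(* Sorting puts the least point first, so that all steps [v - v0] are positive. *)
pose r := sort <=%R (finmap.enum_fset (fset_set (supp f))).
have rP v : (v \in r) = (a v != 0).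
  rewrite mem_sort in_fset_set // -(intr_eq0 (complex R)) -fa.
  by apply/idP/idP; rewrite inE.
have {}ann u : convol r a id h u = 0.
  apply: (@intr_inj (complex R)); rewrite -[RHS](ann u) fsbig_finite //.
  rewrite /convol rmorph_sum (perm_big _ (permEl (perm_sort _ _))) /=.
  by apply: eq_bigr => v _; rewrite rmorphM /= fa ch.
have bh := finite_range_bounded ch c_fin.
have [N hN] := bh; have [m m0 prog] := dilate_annihilator_progression hN ann.
have : uniq r by rewrite sort_uniq finmap.fset_uniq.
have : sorted <=%R r by apply: sort_sorted; exact: le_total.
case: r => [|v0 r] in rP prog ann *.
  move=> _ _; case: f_nz; apply: funext => v; rewrite fa.
  by have /esym/negbFE/eqP -> := rP v.
move=> /(order_path_min le_trans)/allP v0_min /andP[v0r _].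
have a0 : a v0 != 0 by rewrite -rP mem_head.
(* The factor [a v0] stays in the function, since the coefficient at [v0] need not be 1. *)
exists [seq (v - v0) *+ m | v <- r], (fun u => a v0 * h u); split.
- move=> _ /mapP[v vr ->]; rewrite pmulrn_lgt0 // subr_gt0 lt_neqAle v0_min //.
  by rewrite andbT; apply: contraNneq v0r => ->.
- exists (absz (a v0) * N)%N => u; rewrite normrM PoszM abszE.
  by rewrite ler_wpM2l.
- by exists (a v0) => // u; rewrite rmorphM /= ch.
apply: (@eliminate_progression _ _ _ _ _ (fun v u => a v * h (u - (v - v0)))) => j u.
(* Evaluating at this point cancels the dilated shift of [v0]. *)
rewrite -[RHS](prog j (u + v0 *+ (j * m).+1)) /convol big_cons addrK.
congr (_ + _); apply: eq_bigr => v _; congr (_ * h _).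
rewrite -[in LHS]mulrnA mulnC -addrA -opprD -mulrSr mulrnBl opprB.
by rewrite addrA.
Qed.

Theorem theorem6p17 (R : realType) (c : R -> complex R)
    (c_delone : delone_configuration c)
    (c_integral : integral_fun c)
    (c_annihilated : exists f : R -> complex R,
       [/\ annihilator c f, integral_fun f & nontrivial f]) :
  periodic_fun c.
Proof.
have [c_fin [c_dsc _]] := c_delone; have [f [ann f_int f_nz]] := c_annihilated.
have [l [h [l0 bh [n n0 hc] lh]]] :=
  annihilator_bdiffs c_fin c_integral ann f_int f_nz.
have nc0 : n%:~R != 0 :> complex R by rewrite intr_eq0.
(* As [h] is a non-zero multiple of [c], the two have the same support and the same periods. *)
have h_dsc : uniformly_discrete [set u | h u != 0]%classic.
  suff -> : [set u | h u != 0]%classic = supp c by [].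
  apply: funext => u; apply/propext => /=.
  by rewrite -(intr_eq0 (complex R)) hc mulf_eq0 (negPf nc0).
have [s s0 sh] := bdiffs_eq0_periodic h_dsc bh l0 lh.
exists s; first by rewrite gt_eqF.
move=> u; apply: (mulfI nc0); rewrite -!hc.
by have := bdiff_eq0_shift sh u 1; rewrite mulr1n => ->.
Qed.
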